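(* Let $\omega>0$ be independent of $t$, and consider the solution $(A_1,A_2,A_3,p)$ of the system $$2(A_1)_t=A_2\,\omega-\cot\left(\tfrac p2\right)A_1A_3\,\omega,\qquad 2(A_2)_t=-A_1\,\omega-\cot\left(\tfrac p2\right)A_2A_3\,\omega,$$ $$2(A_3)_t=-\cot\left(\tfrac p2\right)(A_3^2-1)\,\omega,\qquad p_t=A_3\,\omega,$$ with initial data at time $t_0$ satisfying $A_1^2+A_2^2+A_3^2=1$. Let $$C:=(1-A_3^2)\,\sin^2\left(\tfrac p2\right),$$ which is constant in $t$ along the solution ($C_t=0$). If $C\neq 0$ and $p(t_0)\in(0,2\pi)$, then $p(t)\in(0,2\pi)$ for all $t\ge t_0$.
   Context: The system arises as follows. A vector function $\vec p=p\,\vec e\in\mathbb{R}^3$ (with $p=|\vec p|$ and $\vec e$ a unit vector) satisfies $p_t=\vec e\cdot\vec\omega$ and $2\vec e_t=\vec e\times\vec\omega-\cot(p/2)\,\vec e\times(\vec e\times\vec\omega)$. The vector $\vec\omega$ is assumed independent of $t$, and Cartesian coordinates $\vec e_1,\vec e_2,\vec e_3$ are chosen with $\vec\omega=\omega\,\vec e_3$, $\omega=|\vec\omega|$, and $\vec e=A_1\vec e_1+A_2\vec e_2+A_3\vec e_3$. All quantities may also depend on a parameter $s$, which is held fixed; the subscript $t$ denotes differentiation with respect to time. The solution is the one determined by its values at $t_0$, continued forward in time. *)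

(* Defs.v *)
From Stdlib Require Import Reals.
From Coquelicot Require Import Coquelicot.
Open Scope R_scope.

(* [cos x / 0] is an unspecified real, so [cot] is only ever used under
   the guard [sin x <> 0]. *)
Definition cot (x : R) : R := cos x / sin x.

(* [T] may be [p_infty]. *)
Definition forward_interval (t0 : R) (T : Rbar) (t : R) : Prop :=
  t0 <= t /\ Rbar_lt t T.

(* The system at time [t]. [D_in f d J t] says that [d t] is the derivative
   of [f] at [t] relative to [J], hence a one-sided derivative at an endpoint. *)
Definition system_at (omega : R) (A1 A2 A3 p : R -> R) (J : R -> Prop) (t : R)
    : Prop :=
  D_in A1 (fun u => (A2 u * omega - cot (p u / 2) * A1 u * A3 u * omega) / 2) J t /\
  D_in A2 (fun u => (- A1 u * omega - cot (p u / 2) * A2 u * A3 u * omega) / 2) J t /\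
  D_in A3 (fun u => (- cot (p u / 2) * ((A3 u) ^ 2 - 1) * omega) / 2) J t /\
  D_in p (fun u => A3 u * omega) J t.

(* Solutions are continuous on [J] and satisfy the system at every time at which
   its right-hand side is defined. The absence of singular times
   ([sin (p t / 2) = 0]) is deliberately not part of the definition: it would by
   itself confine [p] to (0, 2 PI). *)
Definition is_solution (omega : R) (J : R -> Prop) (A1 A2 A3 p : R -> R) : Prop :=
  forall t : R, J t ->
    continue_in A1 J t /\ continue_in A2 J t /\
    continue_in A3 J t /\ continue_in p J t /\
    (sin (p t / 2) <> 0 -> system_at omega A1 A2 A3 p J t).

Definition has_data (t0 a1 a2 a3 p0 : R) (A1 A2 A3 p : R -> R) : Prop :=
  A1 t0 = a1 /\ A2 t0 = a2 /\ A3 t0 = a3 /\ p t0 = p0.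

Definition Cquantity (A3 p : R) : R := (1 - A3 ^ 2) * (sin (p / 2)) ^ 2.

(* Main.v *)
Require Import Defs.
From Stdlib Require Import Reals Lra.
From Coquelicot Require Import Coquelicot.
Open Scope R_scope.

(** The system is the rotation flow of a unit quaternion written in the
    axis-angle coordinates [e = (A1, A2, A3)], [p].  In the coordinates
      [x = cos (p/2)],  [z = sin (p/2) * A3],
      [v = sin (p/2) * A2],  [w = sin (p/2) * A1]
    the cotangents cancel and the equations become linear: with [k = omega / 2],
      [x' = - k z],  [z' = k x],  [v' = - k w],  [w' = k v],
    so both [(x, z)] and [(v, w)] rotate at constant speed [k]
    ([quaternion_derive], [rotation_unique]).

    Moreover [C = 1 - x^2 - z^2], so [C] is conserved as long as
    [sin (p/2) <> 0].  At a singular time [C = 0] whatever [A3] is; hence [C] is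
    a continuous function whose derivative vanishes wherever [C] itself does not,
    and such a function is constant ([const_of_null_derive_off_zero]).

    If [C <> 0] then [C > 0], because [|a3| <= 1], and [x^2 <= 1 - C < 1] for all
    times along the explicit rotation.  So the inverse substitution
    [p = 2 acos x], [Ai = (w, v, z) / sqrt (1 - x^2)] makes sense for ever, takes
    values [p] in (0, 2 PI), and solves the system ([quaternion_inverse]).
    Conversely, conservation of [C] keeps [sin (p/2)] away from 0 along any
    solution with the same data, so that [p] cannot leave (0, 2 PI), and the
    solution is read off from its rotating quaternion, which is the explicit
    one. *)

(** * Passing from one-sided to two-sided calculus *)

(** Freezing a function outside [[a, b]] turns continuity relative to a domain
    containing [[a, b]] into plain continuity on the whole line, endpoints
    included. *)
Definition clamp (a b u : R) : R := Rmax a (Rmin b u).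

Lemma clamp_bounds (a b u : R) : a <= b -> a <= clamp a b u <= b.
Proof.
  intros Hab; unfold clamp, Rmax, Rmin.
  destruct (Rle_dec b u); destruct (Rle_dec a _); lra.
Qed.

Lemma clamp_id (a b u : R) : a <= u <= b -> clamp a b u = u.
Proof.
  intros Hu; unfold clamp, Rmax, Rmin.
  destruct (Rle_dec b u); destruct (Rle_dec a _); lra.
Qed.

Lemma clamp_lipschitz (a b u w : R) :
  a <= b -> Rabs (clamp a b u - clamp a b w) <= Rabs (u - w).
Proof.
  intros Hab; unfold clamp, Rmax, Rmin.
  destruct (Rle_dec b u); destruct (Rle_dec b w);
    repeat destruct (Rle_dec a _); unfold Rabs;
    repeat destruct (Rcase_abs _); lra.
Qed.

Lemma continuity_clamp (f : R -> R) (J : R -> Prop) (a b : R) :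
  a <= b -> (forall u, a <= u <= b -> J u /\ continue_in f J u) ->
  continuity (fun u => f (clamp a b u)).
Proof.
  intros Hab Hf x eps Heps.
  destruct (Hf _ (clamp_bounds a b x Hab)) as [_ Hc].
  destruct (Hc eps Heps) as [alp [Halp Hlim]].
  exists alp; split; [exact Halp|].
  intros u [_ Hu]; simpl in *; unfold Rdist in *.
  destruct (Req_dec (clamp a b x) (clamp a b u)) as [E|E].
  - rewrite E, Rminus_diag, Rabs_R0; exact Heps.
  - apply Hlim; split.
    + split; [|exact E].
      apply (Hf _ (clamp_bounds a b u Hab)).
    + eapply Rle_lt_trans; [apply clamp_lipschitz; exact Hab | exact Hu].
Qed.

Lemma is_derive_clamp (f d : R -> R) (J : R -> Prop) (a b x : R) :
  a < x < b -> (forall u, a <= u <= b -> J u) -> D_in f d J x ->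
  is_derive (fun u => f (clamp a b u)) x (d x).
Proof.
  intros Hx HJ Hd.
  apply is_derive_Reals.
  apply (derivable_pt_lim_locally_ext f _ x a b); [exact Hx| |].
  { intros u Hu; rewrite clamp_id; [reflexivity|lra]. }
  apply derivable_pt_lim_D_in.
  intros eps Heps.
  destruct (Hd eps Heps) as [alp [Halp Hlim]].
  exists (Rmin alp (Rmin (x - a) (b - x))); split.
  { repeat apply Rmin_pos; lra. }
  intros u [[_ Hne] Hu]; simpl in *; unfold Rdist in *.
  assert (Hu1 := Rlt_le_trans _ _ _ Hu (Rmin_l _ _)).
  assert (Hu2 := Rlt_le_trans _ _ _ Hu (Rmin_r _ _)).
  assert (Hu3 := Rlt_le_trans _ _ _ Hu2 (Rmin_l _ _)).
  assert (Hu4 := Rlt_le_trans _ _ _ Hu2 (Rmin_r _ _)).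
  apply Rabs_def2 in Hu3; apply Rabs_def2 in Hu4.
  apply Hlim; repeat split; [apply HJ; lra | exact Hne | exact Hu1].
Qed.

Lemma D_in_of_is_derive (f d : R -> R) (J : R -> Prop) (x : R) :
  is_derive f x (d x) -> D_in f d J x.
Proof.
  intros H; apply is_derive_Reals, derivable_pt_lim_D_in in H.
  apply limit1_imp with (2 := H).
  intros u [_ Hu]; split; [exact I | exact Hu].
Qed.

Definition two_sided_system_at (omega : R) (A1 A2 A3 p : R -> R) (t : R)
    : Prop :=
  is_derive A1 t ((A2 t * omega - cot (p t / 2) * A1 t * A3 t * omega) / 2) /\
  is_derive A2 t ((- A1 t * omega - cot (p t / 2) * A2 t * A3 t * omega) / 2) /\
  is_derive A3 t ((- cot (p t / 2) * ((A3 t) ^ 2 - 1) * omega) / 2) /\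
  is_derive p t (A3 t * omega).

Lemma solution_clamp (omega t0 : R) (T : Rbar) (A1 A2 A3 p : R -> R) (t : R) :
  is_solution omega (forward_interval t0 T) A1 A2 A3 p ->
  forward_interval t0 T t ->
  let cl f := fun u : R => f (clamp t0 t u) : R in
  (continuity (cl A1) /\ continuity (cl A2) /\
   continuity (cl A3) /\ continuity (cl p)) /\
  (forall u, t0 < u < t -> sin (cl p u / 2) <> 0 ->
     two_sided_system_at omega (cl A1) (cl A2) (cl A3) (cl p) u).
Proof.
  intros Hsol [Ht HT] cl.
  assert (HJ : forall u, t0 <= u <= t -> forward_interval t0 T u).
  { intros u Hu; split; [lra|].
    apply Rbar_le_lt_trans with t; [simpl; lra | exact HT]. }
  split.
  { split; [|split; [|split]]; apply (continuity_clamp _ (forward_interval t0 T)); auto;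
      intros u Hu; split; auto; apply (Hsol u (HJ u Hu)). }
  intros u Hu; unfold cl, two_sided_system_at.
  rewrite (clamp_id t0 t u) by lra; intros Hs.
  assert (Hu' : t0 <= u <= t) by lra.
  destruct (Hsol u (HJ u Hu')) as (_ & _ & _ & _ & Hsys).
  destruct (Hsys Hs) as (H1 & H2 & H3 & H4).
  split; [|split; [|split]].
  - exact (is_derive_clamp _ _ _ _ _ _ Hu HJ H1).
  - exact (is_derive_clamp _ _ _ _ _ _ Hu HJ H2).
  - exact (is_derive_clamp _ _ _ _ _ _ Hu HJ H3).
  - exact (is_derive_clamp _ _ _ _ _ _ Hu HJ H4).
Qed.

(** The eta-expanded form is the one in which derivatives of variables appear
    after [auto_derive]. *)
Lemma Derive_eta_unique (f : R -> R) (t l : R) :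
  is_derive f t l -> Derive (fun u => f u) t = l.
Proof. exact (is_derive_unique f t l). Qed.

(** * Constancy criteria *)

Lemma const_of_null_derive (g : R -> R) (a b : R) :
  a <= b -> continuity g -> (forall t, a < t < b -> is_derive g t 0) ->
  g b = g a.
Proof.
  intros Hab Hc Hd.
  destruct (MVT_gen g a b (fun _ => 0)) as [c [_ Hc']].
  - rewrite Rmin_left, Rmax_right by exact Hab; exact Hd.
  - intros; apply Hc.
  - lra.
Qed.

(** Take the last time at which [g <= m]: after it [g] is positive, hence
    constant, so that [g] would have to jump there. *)
Lemma no_rise_off_zero (g : R -> R) (a b m : R) :
  a <= b -> continuity g ->
  (forall t, a < t < b -> g t <> 0 -> is_derive g t 0) ->
  0 <= m -> g a <= m -> ~ m < g b.
Proof.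
  intros Hab Hc Hd Hm Ha Hb.
  pose (E := fun t => a <= t <= b /\ g t <= m).
  destruct (completeness E) as [s [Hub Hlub]].
  { exists b; intros t [Ht _]; lra. }
  { exists a; split; [lra | exact Ha]. }
  assert (Has : a <= s) by (apply Hub; split; [lra | exact Ha]).
  assert (Hsb : s <= b) by (apply Hlub; intros t [Ht _]; lra).
  assert (Hgs : g b = g s).
  { apply const_of_null_derive; [exact Hsb | exact Hc |].
    intros t Ht; apply Hd; [lra|].
    intros H0.
    enough (t <= s) by lra.
    apply Hub; split; lra. }
  destruct (Hc s (g s - m)) as [alp [Halp Hlim]]; [lra|].
  (* Near [s] the values exceed [m], so [s - alp] is already an upper bound. *)
  enough (s <= s - alp) by lra.
  apply Hlub; intros t Ht.
  destruct (Rle_dec t (s - alp)) as [|Hn]; [assumption|exfalso].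
  assert (Hts : t <= s) by (apply Hub; exact Ht).
  destruct Ht as [_ Ht].
  destruct (Req_dec s t) as [<-|Hne]; [lra|].
  assert (H : Rabs (g t - g s) < g s - m).
  { apply Hlim; simpl; unfold Rdist; split.
    - split; [exact I | exact Hne].
    - apply Rabs_def1; lra. }
  apply Rabs_def2 in H; lra.
Qed.

(** A rise of [g] to a positive value is excluded directly; a rise from a
    negative value is one to a positive value for [t |-> - g (a + b - t)]. *)
Lemma no_rise (g : R -> R) (a b : R) :
  a <= b -> continuity g ->
  (forall t, a < t < b -> g t <> 0 -> is_derive g t 0) ->
  ~ g a < g b.
Proof.
  intros Hab Hc Hd H.
  destruct (Rlt_dec 0 (g b)) as [Hp|Hn].
  - apply (no_rise_off_zero g a b (Rmax 0 (g a))); auto using Rmax_l, Rmax_r.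
    apply Rmax_lub_lt; assumption.
  - apply (no_rise_off_zero (fun t => - g (a + b - t)) a b (- g b)).
    + exact Hab.
    + apply continuity_opp; apply (continuity_comp (fun t => a + b - t) g);
        [|exact Hc].
      apply derivable_continuous; reg.
    + intros t Ht Hgt.
      assert (Hg := Hd (a + b - t) ltac:(lra) ltac:(lra)).
      evar_last.
      { apply (is_derive_opp (fun t => g (a + b - t))).
        apply (is_derive_comp g (fun t => a + b - t)); [exact Hg|].
        auto_derive; [exact I | reflexivity]. }
      unfold opp, scal, mult; simpl; unfold mult; simpl; ring.
    + lra.
    + replace (a + b - a) with b by ring; lra.
    + replace (a + b - b) with a by ring; lra.
Qed.

Lemma const_of_null_derive_off_zero (g : R -> R) (a b : R) :
  a <= b -> continuity g ->
  (forall t, a < t < b -> g t <> 0 -> is_derive g t 0) ->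
  g b = g a.
Proof.
  intros Hab Hc Hd.
  destruct (Rtotal_order (g a) (g b)) as [H|[H|H]]; [|auto|].
  - destruct (no_rise g a b Hab Hc Hd H).
  - destruct (no_rise (fun t => - g t) a b Hab); [| |lra].
    + apply continuity_opp; exact Hc.
    + intros t Ht Hg.
      replace 0 with (- 0) by ring.
      apply (is_derive_opp g); apply Hd; [exact Ht | lra].
Qed.

(** * Rotation at constant speed *)

Definition rot_re (k t0 f0 g0 t : R) : R :=
  f0 * cos (k * (t - t0)) - g0 * sin (k * (t - t0)).

Definition rot_im (k t0 f0 g0 t : R) : R :=
  f0 * sin (k * (t - t0)) + g0 * cos (k * (t - t0)).

Lemma is_derive_rot_re (k t0 f0 g0 t : R) :
  is_derive (rot_re k t0 f0 g0) t (- k * rot_im k t0 f0 g0 t).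
Proof.
  unfold rot_re, rot_im, Rminus; auto_derive; [exact I | ring].
Qed.

Lemma is_derive_rot_im (k t0 f0 g0 t : R) :
  is_derive (rot_im k t0 f0 g0) t (k * rot_re k t0 f0 g0 t).
Proof.
  unfold rot_re, rot_im, Rminus; auto_derive; [exact I | ring].
Qed.

Lemma cos2_sin2 (y : R) : cos y * cos y = 1 - sin y * sin y.
Proof. generalize (sin2_cos2 y); unfold Rsqr; lra. Qed.

Lemma rot_norm (k t0 f0 g0 t : R) :
  rot_re k t0 f0 g0 t ^ 2 + rot_im k t0 f0 g0 t ^ 2 = f0 ^ 2 + g0 ^ 2.
Proof.
  unfold rot_re, rot_im; ring [(cos2_sin2 (k * (t - t0)))].
Qed.

Lemma rot_start (k t0 f0 g0 : R) :
  rot_re k t0 f0 g0 t0 = f0 /\ rot_im k t0 f0 g0 t0 = g0.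
Proof.
  unfold rot_re, rot_im.
  rewrite Rminus_diag, Rmult_0_r, cos_0, sin_0; split; ring.
Qed.

(** In the frame rotating with the flow every solution is at rest. *)
Lemma rotation_unique (k a b : R) (f g : R -> R) :
  a <= b -> continuity f -> continuity g ->
  (forall t, a < t < b -> is_derive f t (- k * g t) /\ is_derive g t (k * f t)) ->
  f b = rot_re k a (f a) (g a) b /\ g b = rot_im k a (f a) (g a) b.
Proof.
  intros Hab Hf Hg Hd.
  pose (F := fun t => f t * cos (k * (t - a)) + g t * sin (k * (t - a))).
  pose (G := fun t => g t * cos (k * (t - a)) - f t * sin (k * (t - a))).
  assert (Hcos : continuity (fun t => cos (k * (t - a))))
    by (apply derivable_continuous; reg).
  assert (Hsin : continuity (fun t => sin (k * (t - a))))
    by (apply derivable_continuous; reg).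
  assert (HF : F b = F a).
  { apply const_of_null_derive; [exact Hab| |].
    - apply (continuity_plus (fun t => f t * cos (k * (t - a)))
                             (fun t => g t * sin (k * (t - a))));
        apply continuity_mult; assumption.
    - intros t Ht; destruct (Hd t Ht) as [H1 H2]; unfold F, Rminus.
      auto_derive; [repeat split; eexists; eassumption|].
      rewrite (Derive_eta_unique _ _ _ H1), (Derive_eta_unique _ _ _ H2); ring. }
  assert (HG : G b = G a).
  { apply const_of_null_derive; [exact Hab| |].
    - apply (continuity_minus (fun t => g t * cos (k * (t - a)))
                              (fun t => f t * sin (k * (t - a))));
        apply continuity_mult; assumption.
    - intros t Ht; destruct (Hd t Ht) as [H1 H2]; unfold G, Rminus.
      auto_derive; [repeat split; eexists; eassumption|].
      rewrite (Derive_eta_unique _ _ _ H1), (Derive_eta_unique _ _ _ H2); ring. }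
  assert (HFa : F a = f a)
    by (unfold F; rewrite Rminus_diag, Rmult_0_r, cos_0, sin_0; ring).
  assert (HGa : G a = g a)
    by (unfold G; rewrite Rminus_diag, Rmult_0_r, cos_0, sin_0; ring).
  unfold rot_re, rot_im; rewrite <- HFa, <- HGa, <- HF, <- HG; unfold F, G.
  split; ring [(cos2_sin2 (k * (b - a)))].
Qed.

(** * The quaternion substitution *)

Lemma quaternion_derive (omega : R) (A1 A2 A3 p : R -> R) (t : R) :
  sin (p t / 2) <> 0 -> two_sided_system_at omega A1 A2 A3 p t ->
  let k := omega / 2 in
  let x := fun u => cos (p u / 2) in
  let z := fun u => sin (p u / 2) * A3 u in
  let v := fun u => sin (p u / 2) * A2 u in
  let w := fun u => sin (p u / 2) * A1 u in
  (is_derive x t (- k * z t) /\ is_derive z t (k * x t)) /\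
  (is_derive v t (- k * w t) /\ is_derive w t (k * v t)).
Proof.
  intros Hs (H1 & H2 & H3 & H4) k x z v w.
  assert (E1 := Derive_eta_unique _ _ _ H1); assert (E2 := Derive_eta_unique _ _ _ H2).
  assert (E3 := Derive_eta_unique _ _ _ H3); assert (E4 := Derive_eta_unique _ _ _ H4).
  unfold k, x, z, v, w; split; split;
    (auto_derive; [repeat split; eexists; eassumption|]);
    rewrite ?E1, ?E2, ?E3, ?E4; unfold cot, Rdiv in *; field; exact Hs.
Qed.

Lemma Cquantity_derive (omega : R) (A1 A2 A3 p : R -> R) (t : R) :
  sin (p t / 2) <> 0 -> two_sided_system_at omega A1 A2 A3 p t ->
  is_derive (fun u => Cquantity (A3 u) (p u)) t 0.
Proof.
  intros Hs (_ & _ & H3 & H4); unfold Cquantity.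
  auto_derive; [repeat split; eexists; eassumption|].
  rewrite (Derive_eta_unique _ _ _ H3), (Derive_eta_unique _ _ _ H4).
  unfold cot, Rdiv in *; field; exact Hs.
Qed.

Lemma is_derive_acos (x : R) : -1 < x < 1 -> is_derive acos x (- / sqrt (1 - x ^ 2)).
Proof.
  intros Hx; apply is_derive_Reals.
  replace (- / sqrt (1 - x ^ 2)) with (derive_pt acos x (derivable_pt_acos x Hx)).
  - apply (derive_pt_eq_1 _ _ _ (derivable_pt_acos x Hx)); reflexivity.
  - rewrite derive_pt_acos; unfold Rdiv, Rsqr.
    replace (x ^ 2) with (x * x) by ring; ring.
Qed.

Lemma quaternion_inverse (omega : R) (x z v w : R -> R) (t : R) :
  let k := omega / 2 in
  -1 < x t < 1 ->
  is_derive x t (- k * z t) -> is_derive z t (k * x t) ->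
  is_derive v t (- k * w t) -> is_derive w t (k * v t) ->
  let s := fun u => sqrt (1 - x u ^ 2) in
  two_sided_system_at omega (fun u => w u / s u) (fun u => v u / s u)
    (fun u => z u / s u) (fun u => 2 * acos (x u)) t.
Proof.
  intros k Hx Dx Dz Dv Dw s.
  assert (Hpos : 0 < 1 - x t ^ 2) by nra.
  assert (Hs : 0 < s t) by (apply sqrt_lt_R0; exact Hpos).
  assert (Hs2 : s t * s t = 1 - x t ^ 2) by (apply sqrt_sqrt; lra).
  assert (Ds : is_derive s t (k * x t * z t / s t)).
  { unfold s; auto_derive; [repeat split; [eexists; eassumption | lra]|].
    rewrite (Derive_eta_unique _ _ _ Dx).
    replace (1 + - (x t * (x t * 1))) with (1 - x t ^ 2) by ring.
    fold (s t); field; lra. }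
  assert (Hcot : cot (2 * acos (x t) / 2) = x t / s t).
  { unfold cot.
    replace (2 * acos (x t) / 2) with (acos (x t)) by field.
    rewrite cos_acos, sin_acos by lra.
    unfold s; replace (x t ^ 2) with ((x t)²) by (unfold Rsqr; ring).
    reflexivity. }
  assert (Ex := Derive_eta_unique _ _ _ Dx); assert (Ez := Derive_eta_unique _ _ _ Dz).
  assert (Ev := Derive_eta_unique _ _ _ Dv); assert (Ew := Derive_eta_unique _ _ _ Dw).
  assert (Es := Derive_eta_unique _ _ _ Ds).
  unfold two_sided_system_at; rewrite Hcot.
  split; [|split; [|split]].
  - auto_derive; [repeat split; try (eexists; eassumption); lra|].
    rewrite Ew, Es; unfold k; field; lra.
  - auto_derive; [repeat split; try (eexists; eassumption); lra|].
    rewrite Ev, Es; unfold k; field; lra.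
  - auto_derive; [repeat split; try (eexists; eassumption); lra|].
    rewrite Ez, Es; unfold k; field; lra.
  - evar_last.
    { apply is_derive_scal.
      apply (is_derive_comp acos x); [apply is_derive_acos; exact Hx | exact Dx]. }
    change (2 * (- k * z t * - / s t) = z t / s t * omega).
    unfold k; field; lra.
Qed.

(** * Conservation of the invariant and confinement of the angle *)

Lemma Cquantity_conserved (omega t0 : R) (T : Rbar) (A1 A2 A3 p : R -> R) (t : R) :
  is_solution omega (forward_interval t0 T) A1 A2 A3 p ->
  forward_interval t0 T t ->
  Cquantity (A3 t) (p t) = Cquantity (A3 t0) (p t0).
Proof.
  intros Hsol Ht.
  destruct (solution_clamp _ _ _ _ _ _ _ _ Hsol Ht)
    as [(_ & _ & C3 & Cp) Hd].
  destruct Ht as [Ht _].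
  assert (H := const_of_null_derive_off_zero
    (fun u => Cquantity (A3 (clamp t0 t u)) (p (clamp t0 t u))) t0 t Ht).
  simpl in H; rewrite !clamp_id in H by lra; apply H; clear H.
  - unfold Cquantity; apply continuity_mult.
    + apply (continuity_comp (fun u => A3 (clamp t0 t u)) (fun y => 1 - y ^ 2) C3).
      apply derivable_continuous; reg.
    + apply (continuity_comp (fun u => p (clamp t0 t u)) (fun y => sin (y / 2) ^ 2) Cp).
      apply derivable_continuous; reg.
  - intros u Hu HC.
    assert (Hs : sin (p (clamp t0 t u) / 2) <> 0).
    { intros E; apply HC; unfold Cquantity; rewrite E; ring. }
    exact (Cquantity_derive _ _ _ _ _ _ Hs (Hd u Hu Hs)).
Qed.

Lemma sin_half_pos (y : R) : 0 < y < 2 * PI -> 0 < sin (y / 2).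
Proof. intros Hy; apply sin_gt_0; lra. Qed.

(** To leave (0, 2 PI) the angle would have to cross 0 or [2 * PI], zeros of
    [sin (y / 2)]. *)
Lemma confined (q : R -> R) (a b : R) :
  a <= b -> continuity q -> 0 < q a < 2 * PI ->
  (forall u, a <= u <= b -> sin (q u / 2) <> 0) -> 0 < q b < 2 * PI.
Proof.
  intros Hab Hc Ha Hs.
  assert (Hvalue : forall y, sin (y / 2) = 0 -> ~ Rmin (q a) (q b) <= y <= Rmax (q a) (q b)).
  { intros y Hy Hyq.
    destruct (IVT_gen q a b y Hc Hyq) as [u [Hu Eu]].
    rewrite Rmin_left, Rmax_right in Hu by exact Hab.
    apply (Hs u Hu); rewrite Eu; exact Hy. }
  split; apply Rnot_le_lt; intros Hb.
  - apply (Hvalue 0).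
    + rewrite Rdiv_0_l; apply sin_0.
    + split; [eapply Rle_trans; [apply Rmin_r | lra]
             | eapply Rle_trans; [|apply Rmax_l]; lra].
  - apply (Hvalue (2 * PI)).
    + replace (2 * PI / 2) with PI by field; apply sin_PI.
    + split; [eapply Rle_trans; [apply Rmin_l | lra]
             | eapply Rle_trans; [|apply Rmax_r]; lra].
Qed.

(** A singular time would force [C = 0], so conservation of [C] makes the linear
    equations valid at every time; they then determine the quaternion. *)
Lemma solution_quaternion (omega t0 : R) (T : Rbar) (A1 A2 A3 p : R -> R) (t : R) :
  is_solution omega (forward_interval t0 T) A1 A2 A3 p ->
  forward_interval t0 T t ->
  Cquantity (A3 t0) (p t0) <> 0 -> 0 < p t0 < 2 * PI ->
  let k := omega / 2 in
  let x0 := cos (p t0 / 2) in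
  let s0 := sin (p t0 / 2) in
  0 < p t < 2 * PI /\
  cos (p t / 2) = rot_re k t0 x0 (s0 * A3 t0) t /\
  sin (p t / 2) * A3 t = rot_im k t0 x0 (s0 * A3 t0) t /\
  sin (p t / 2) * A2 t = rot_re k t0 (s0 * A2 t0) (s0 * A1 t0) t /\
  sin (p t / 2) * A1 t = rot_im k t0 (s0 * A2 t0) (s0 * A1 t0) t.
Proof.
  intros Hsol Ht HC Hp0 k x0 s0.
  destruct (solution_clamp _ _ _ _ _ _ _ _ Hsol Ht)
    as [(C1 & C2 & C3 & Cp) Hd].
  assert (Hns : forall u, t0 <= u <= t -> sin (p (clamp t0 t u) / 2) <> 0).
  { intros u Hu E; rewrite clamp_id in E by exact Hu.
    apply HC.
    rewrite <- (Cquantity_conserved _ _ _ _ _ _ _ u Hsol).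
    - unfold Cquantity; rewrite E; ring.
    - destruct Ht as [_ HT]; split; [lra|].
      apply Rbar_le_lt_trans with t; [simpl; lra | exact HT]. }
  destruct Ht as [Ht _].
  assert (Csin : continuity (fun u => sin (p (clamp t0 t u) / 2))).
  { apply (continuity_comp (fun u => p (clamp t0 t u)) (fun y => sin (y / 2)) Cp).
    apply derivable_continuous; reg. }
  assert (Ccos : continuity (fun u => cos (p (clamp t0 t u) / 2))).
  { apply (continuity_comp (fun u => p (clamp t0 t u)) (fun y => cos (y / 2)) Cp).
    apply derivable_continuous; reg. }
  assert (Hq := fun u (Hu : t0 < u < t) =>
    let Hs := Hns u (conj (Rlt_le _ _ (proj1 Hu)) (Rlt_le _ _ (proj2 Hu))) in
    quaternion_derive _ _ _ _ _ u Hs (Hd u Hu Hs)).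
  cbv zeta beta in Hq.
  split.
  - assert (H := confined _ t0 t Ht Cp); simpl in H.
    rewrite !clamp_id in H by lra; apply H; assumption.
  - assert (HXZ := rotation_unique k t0 t _ _ Ht Ccos
      (continuity_mult _ _ Csin C3) (fun u Hu => proj1 (Hq u Hu))).
    assert (HVW := rotation_unique k t0 t _ _ Ht (continuity_mult _ _ Csin C2)
      (continuity_mult _ _ Csin C1) (fun u Hu => proj2 (Hq u Hu))).
    unfold mult_fct in HXZ, HVW; rewrite !clamp_id in HXZ, HVW by lra.
    destruct HXZ, HVW; repeat split; assumption.
Qed.

(** * Global existence, uniqueness and confinement *)

Theorem proposition2 (omega t0 a1 a2 a3 p0 : R)
    (homega : 0 < omega)
    (hunit : a1 ^ 2 + a2 ^ 2 + a3 ^ 2 = 1) :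
  (forall (T : Rbar) (A1 A2 A3 p : R -> R),
      is_solution omega (forward_interval t0 T) A1 A2 A3 p ->
      has_data t0 a1 a2 a3 p0 A1 A2 A3 p ->
      forall t : R, forward_interval t0 T t ->
        Cquantity (A3 t) (p t) = Cquantity a3 p0) /\
  (Cquantity a3 p0 <> 0 -> 0 < p0 < 2 * PI ->
    exists A1 A2 A3 p : R -> R,
      is_solution omega (forward_interval t0 p_infty) A1 A2 A3 p /\
      has_data t0 a1 a2 a3 p0 A1 A2 A3 p /\
      (forall (T : Rbar) (B1 B2 B3 q : R -> R),
          is_solution omega (forward_interval t0 T) B1 B2 B3 q ->
          has_data t0 a1 a2 a3 p0 B1 B2 B3 q ->
          forall t : R, forward_interval t0 T t ->
            B1 t = A1 t /\ B2 t = A2 t /\ B3 t = A3 t /\ q t = p t) /\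
      (forall t : R, t0 <= t -> 0 < p t < 2 * PI)).
Proof.
  split.
  { intros T A1 A2 A3 p Hsol (_ & _ & <- & <-) t Ht.
    exact (Cquantity_conserved _ _ _ _ _ _ _ t Hsol Ht). }
  intros HC Hp0.
  pose (k := omega / 2); pose (x0 := cos (p0 / 2)); pose (s0 := sin (p0 / 2)).
  pose (x := rot_re k t0 x0 (s0 * a3)); pose (z := rot_im k t0 x0 (s0 * a3)).
  pose (v := rot_re k t0 (s0 * a2) (s0 * a1)).
  pose (w := rot_im k t0 (s0 * a2) (s0 * a1)).
  pose (s := fun u => sqrt (1 - x u ^ 2)).
  assert (Hs0 : 0 < s0) by (apply sin_half_pos; exact Hp0).
  assert (Hxs0 : x0 * x0 = 1 - s0 * s0) by apply cos2_sin2.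
  (* [x^2 <= x^2 + z^2 = 1 - C < 1], and [C > 0] because [a3^2 <= 1]. *)
  assert (Hx : forall t, -1 < x t < 1).
  { intros t.
    assert (HCpos : 0 < Cquantity a3 p0).
    { assert (0 <= Cquantity a3 p0)
        by (unfold Cquantity; apply Rmult_le_pos; nra).
      lra. }
    assert (Hn := rot_norm k t0 x0 (s0 * a3) t).
    fold (x t) (z t) in Hn.
    assert (HCe : x0 ^ 2 + (s0 * a3) ^ 2 = 1 - Cquantity a3 p0)
      by (unfold Cquantity; fold s0; ring [Hxs0]).
    nra. }
  destruct (rot_start k t0 x0 (s0 * a3)) as [Ix Iz].
  destruct (rot_start k t0 (s0 * a2) (s0 * a1)) as [Iv Iw].
  fold x in Ix; fold z in Iz; fold v in Iv; fold w in Iw.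
  assert (Is : s t0 = s0).
  { unfold s; rewrite Ix.
    replace (1 - x0 ^ 2) with (s0 ^ 2) by ring [Hxs0].
    apply sqrt_pow2; lra. }
  exists (fun u => w u / s u), (fun u => v u / s u), (fun u => z u / s u),
    (fun u => 2 * acos (x u)).
  split; [|split; [|split]].
  - intros t _.
    destruct (quaternion_inverse omega x z v w t (Hx t)
                (is_derive_rot_re _ _ _ _ _) (is_derive_rot_im _ _ _ _ _)
                (is_derive_rot_re _ _ _ _ _) (is_derive_rot_im _ _ _ _ _))
      as (D1 & D2 & D3 & D4).
    assert (Hsys : system_at omega (fun u => w u / s u) (fun u => v u / s u)
      (fun u => z u / s u) (fun u => 2 * acos (x u))
      (forward_interval t0 p_infty) t).
    { split; [|split; [|split]]; apply D_in_of_is_derive; assumption. }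
    assert (Hsys' := Hsys); destruct Hsys' as (E1 & E2 & E3 & E4).
    do 4 (split; [eapply cont_deriv; eassumption|]).
    intros _; exact Hsys.
  - unfold has_data; rewrite Is, Iw, Iv, Iz, Ix.
    repeat split; try (field; lra).
    unfold x0; rewrite acos_cos by lra; field.
  - intros T B1 B2 B3 q Hsol (<- & <- & <- & <-) t Ht.
    destruct (solution_quaternion _ _ _ _ _ _ _ t Hsol Ht HC Hp0)
      as (Hq & Ex & Ez & Ev & Ew).
    fold k x0 s0 in Ex, Ez, Ev, Ew.
    fold (x t) in Ex; fold (z t) in Ez; fold (v t) in Ev; fold (w t) in Ew.
    assert (Hst : s t = sin (q t / 2)).
    { unfold s; rewrite <- Ex.
      replace (1 - cos (q t / 2) ^ 2) with (sin (q t / 2) ^ 2)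
        by ring [(cos2_sin2 (q t / 2))].
      apply sqrt_pow2, Rlt_le, sin_half_pos, Hq. }
    assert (Hpos := sin_half_pos _ Hq).
    rewrite Hst, <- Ex, <- Ez, <- Ev, <- Ew.
    repeat split; try (field; lra).
    rewrite acos_cos by lra; field.
  - intros t _; assert (H := acos_bound_lt _ (Hx t)); lra.
Qed.
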